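(* The category $\mathsf{C4^c}$, whose objects are the complete Boolean contact algebras satisfying (C4$^c$) and whose morphisms are the $p$-morphisms, is isomorphic to the category $\mathsf{KTB^c}$, whose objects are the complete KTB-algebras and whose morphisms are the homomorphisms of modal algebras.
   Context: A Boolean contact algebra is a pair $\langle\mathfrak{B},\mathsf{C}\rangle$ where $\mathfrak{B}=\langle B,\cdot,+,-,\mathbf{0},\mathbf{1}\rangle$ is a Boolean algebra and $\mathsf{C}\subseteq B\times B$ satisfies, for all $x,y,z\in B$: (C0) not $\mathbf{0}\mathrel{\mathsf{C}}x$; (C1) if $x\le y$ and $x\ne\mathbf{0}$, then $x\mathrel{\mathsf{C}}y$; (C2) if $x\mathrel{\mathsf{C}}y$, then $y\mathrel{\mathsf{C}}x$; (C3) if $x\le y$ and $z\mathrel{\mathsf{C}}x$, then $z\mathrel{\mathsf{C}}y$; (C4) if $x\mathrel{\mathsf{C}}(y+z)$, then $x\mathrel{\mathsf{C}}y$ or $x\mathrel{\mathsf{C}}z$. It is complete if $\mathfrak{B}$ is complete. (C4$^c$): for every $x\in B$ and every $J\subseteq B$, if $x\mathrel{\mathsf{C}}\bigvee J$, then there is $y\in J$ with $x\mathrel{\mathsf{C}}y$. Write $x\ll y$ iff not $x\mathrel{\mathsf{C}}(-y)$. A $p$-morphism from $\langle\mathfrak{B}_1,\mathsf{C}_1\rangle$ to $\langle\mathfrak{B}_2,\mathsf{C}_2\rangle$ is a homomorphism of Boolean algebras $h\colon B_1\to B_2$ such that (P1) for all $x,y\in B_1$: if $h(x)\mathrel{\mathsf{C}_2}h(y)$,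 then $x\mathrel{\mathsf{C}_1}y$; (P2) for all $z\in B_1$, $y\in B_2$: if $h(z)\ll_2 y$, then there is $x\in B_1$ with $z\ll_1 x$ and $h(x)\leq y$. A KTB-algebra is a modal algebra $\langle\mathfrak{B},\Diamond\rangle$ ($\mathfrak{B}$ a Boolean algebra, $\Diamond\colon B\to B$ with $\Diamond\mathbf{0}=\mathbf{0}$ and $\Diamond(x+y)=\Diamond x+\Diamond y$) such that $x\leq\Diamond x$ and $\Diamond\Box x\leq x$ for all $x$, where $\Box x=-\Diamond(-x)$; it is complete if $\mathfrak{B}$ is complete. A homomorphism of modal algebras is a Boolean homomorphism $h$ with $h(\Diamond_1 x)=\Diamond_2 h(x)$ (no preservation of infinite joins is required). Two categories are isomorphic if there are functors $F$, $G$ between them with $G\circ F$ and $F\circ G$ equal to the identity functors. *)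

(* Defs.v *)
From mathcomp Require Import all_boot all_order.
From mathcomp Require Import boolp classical_sets.

Set Implicit Arguments.
Unset Strict Implicit.
Unset Printing Implicit Defensive.

Import Order.TTheory.
Local Open Scope order_scope.

#[local] Obligation Tactic := idtac.

Record category := Category {
  obj : Type;
  hom : obj -> obj -> Type;
  idm : forall A, hom A A;
  compm : forall A B C, hom B C -> hom A B -> hom A C;
  compm_id_l : forall A B (f : hom A B), compm (idm B) f = f;
  compm_id_r : forall A B (f : hom A B), compm f (idm A) = f;
  compmA : forall A B C D (h : hom C D) (g : hom B C) (f : hom A B),
    compm h (compm g f) = compm (compm h g) f
}.
Arguments hom {c} A B.
Arguments idm {c} A.
Arguments compm {c A B C} g f.

Record functor (C D : category) := Functor {
  fobj : obj C -> obj D;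
  fhom : forall A B, hom A B -> hom (fobj A) (fobj B);
  fhom_id : forall A, fhom (idm A) = idm (fobj A);
  fhom_comp : forall (A B E : obj C) (g : hom B E) (f : hom A B),
    fhom (compm g f) = compm (fhom g) (fhom f)
}.

Definition functor_id (C : category) : functor C C :=
  @Functor C C id (fun _ _ f => f) (fun _ => erefl) (fun _ _ _ _ _ => erefl).

Program Definition functor_comp (C D E : category)
    (G : functor D E) (F : functor C D) : functor C E :=
  @Functor C E (fun A => fobj G (fobj F A))
    (fun _ _ f => fhom G (fhom F f)) _ _.
Next Obligation. by move=> C D E G F A; rewrite /= !fhom_id. Qed.
Next Obligation. by move=> C D E G F A B K g f; rewrite /= !fhom_comp. Qed.

(* The equalities are Leibniz equalities of functors, so this is isomorphism
   and not mere equivalence of categories. *)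
Definition isomorphic_categories (C D : category) : Prop :=
  exists (F : functor C D) (G : functor D C),
    functor_comp G F = functor_id C /\ functor_comp F G = functor_id D.

Definition full_subcategory (C : category) (P : obj C -> Prop) : category :=
  @Category {A : obj C | P A} (fun A B => hom (sval A) (sval B))
    (fun A => idm (sval A)) (fun _ _ _ g f => compm g f)
    (fun _ _ f => compm_id_l f) (fun _ _ f => compm_id_r f)
    (fun _ _ _ _ h g f => compmA h g f).

(* Boolean algebras are MathComp's complemented distributive lattices with top
   and bottom; the one-element algebra is allowed.  The display [d] is a phantom
   parameter controlling notations, with no mathematical content. *)

Definition complete_lattice d (B : latticeType d) : Prop :=
  forall J : set B, exists s : B, supremums J s.

Record boolean_morphism d (B1 B2 : ctbDistrLatticeType d) (h : B1 -> B2)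
    : Prop := BooleanMorphism {
  bool_morphI : Order.meet_morphism h;
  bool_morphU : Order.join_morphism h;
  bool_morphC : forall x, h (~` x) = ~` h x;
  bool_morph0 : h \bot = \bot;
  bool_morph1 : h \top = \top
}.

Lemma boolean_morphism_id d (B : ctbDistrLatticeType d) :
  boolean_morphism (fun x : B => x).
Proof. by split. Qed.

Lemma boolean_morphism_comp d (B1 B2 B3 : ctbDistrLatticeType d)
    (g : B2 -> B3) (h : B1 -> B2) :
  boolean_morphism g -> boolean_morphism h ->
  boolean_morphism (fun x => g (h x)).
Proof.
move=> [gI gU gC g0 g1] [hI hU hC h0 h1]; split.
- by move=> x y /=; rewrite hI gI.
- by move=> x y /=; rewrite hU gU.
- by move=> x /=; rewrite hC gC.
- by rewrite h0 g0.
- by rewrite h1 g1.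
Qed.

Record contact_algebra d := ContactAlgebra {
  ca_carrier :> ctbDistrLatticeType d;
  contact : ca_carrier -> ca_carrier -> Prop;
  contact0 : forall x, ~ contact \bot x;
  contact1 : forall x y, x <= y -> x <> \bot -> contact x y;
  contact2 : forall x y, contact x y -> contact y x;
  contact3 : forall x y z, x <= y -> contact z x -> contact z y;
  contact4 : forall x y z, contact x (y `|` z) -> contact x y \/ contact x z
}.
Arguments contact {d c} x y.

Definition well_inside d (A : contact_algebra d) (x y : A) : Prop :=
  ~ contact x (~` y).

(* [supremums J s] says that [s] is the join of [J]. *)
Definition contact4c d (A : contact_algebra d) : Prop :=
  forall (x : A) (J : set A) (s : A),
    supremums J s -> contact x s -> exists2 y, J y & contact x y.

Record p_morphism d (A1 A2 : contact_algebra d) := PMorphism {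
  pm_fun :> A1 -> A2;
  pm_bool : boolean_morphism pm_fun;
  pm_contact : forall x y, contact (pm_fun x) (pm_fun y) -> contact x y;
  pm_lift : forall (z : A1) (y : A2), well_inside (pm_fun z) y ->
    exists2 x, well_inside z x & pm_fun x <= y
}.

Lemma p_morphism_inj d (A1 A2 : contact_algebra d) (f g : p_morphism A1 A2) :
  pm_fun f = pm_fun g -> f = g.
Proof.
case: f g => [f f1 f2 f3] [g g1 g2 g3] /= E; rewrite {}E in f1 f2 f3 *.
by congr PMorphism; apply: Prop_irrelevance.
Qed.

Definition p_morphism_id d (A : contact_algebra d) : p_morphism A A :=
  @PMorphism d A A (fun x => x) (boolean_morphism_id A) (fun _ _ xCy => xCy)
    (fun z y zy => ex_intro2 _ _ y zy (lexx y)).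

Lemma boolean_morphism_homo d (B1 B2 : ctbDistrLatticeType d) (h : B1 -> B2) :
  boolean_morphism h -> {homo h : x y / x <= y}.
Proof. by case=> hI _ _ _ _ x y; rewrite !leEmeet -hI => /eqP ->. Qed.

Program Definition p_morphism_comp d (A1 A2 A3 : contact_algebra d)
    (g : p_morphism A2 A3) (f : p_morphism A1 A2) : p_morphism A1 A3 :=
  @PMorphism d A1 A3 (fun x => g (f x))
    (boolean_morphism_comp (pm_bool g) (pm_bool f)) _ _.
Next Obligation.
by move=> d A1 A2 A3 g f x y /pm_contact /pm_contact.
Qed.
Next Obligation.
move=> d A1 A2 A3 g f z y /pm_lift[x2 /pm_lift[x1 zx1 fx1] gx2].
exists x1 => //; apply: le_trans gx2.
exact: boolean_morphism_homo (pm_bool g) _ _ fx1.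
Qed.

Program Definition contact_category d : category :=
  @Category (contact_algebra d) (@p_morphism d) (@p_morphism_id d)
    (@p_morphism_comp d) _ _ _.
Next Obligation. by move=> *; apply: p_morphism_inj. Qed.
Next Obligation. by move=> *; apply: p_morphism_inj. Qed.
Next Obligation. by move=> *; apply: p_morphism_inj. Qed.

Record modal_algebra d := ModalAlgebra {
  ma_carrier :> ctbDistrLatticeType d;
  dia : ma_carrier -> ma_carrier;
  dia0 : dia \bot = \bot;
  diaU : forall x y, dia (x `|` y) = dia x `|` dia y
}.
Arguments dia {d m} x.

Definition box d (A : modal_algebra d) (x : A) : A := ~` dia (~` x).

Definition KTB_algebra d (A : modal_algebra d) : Prop :=
  (forall x : A, x <= dia x) /\ (forall x : A, dia (box x) <= x).

Record modal_morphism d (A1 A2 : modal_algebra d) := ModalMorphism {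
  mm_fun :> A1 -> A2;
  mm_bool : boolean_morphism mm_fun;
  mm_dia : forall x, mm_fun (dia x) = dia (mm_fun x)
}.

Lemma modal_morphism_inj d (A1 A2 : modal_algebra d)
    (f g : modal_morphism A1 A2) : mm_fun f = mm_fun g -> f = g.
Proof.
case: f g => [f f1 f2] [g g1 g2] /= E; rewrite {}E in f1 f2 *.
by congr ModalMorphism; apply: Prop_irrelevance.
Qed.

Definition modal_morphism_id d (A : modal_algebra d) : modal_morphism A A :=
  @ModalMorphism d A A (fun x => x) (boolean_morphism_id A) (fun _ => erefl).

Program Definition modal_morphism_comp d (A1 A2 A3 : modal_algebra d)
    (g : modal_morphism A2 A3) (f : modal_morphism A1 A2) :
    modal_morphism A1 A3 :=
  @ModalMorphism d A1 A3 (fun x => g (f x))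
    (boolean_morphism_comp (mm_bool g) (mm_bool f)) _.
Next Obligation. by move=> d A1 A2 A3 g f x /=; rewrite !mm_dia. Qed.

Program Definition modal_category d : category :=
  @Category (modal_algebra d) (@modal_morphism d) (@modal_morphism_id d)
    (@modal_morphism_comp d) _ _ _.
Next Obligation. by move=> *; apply: modal_morphism_inj. Qed.
Next Obligation. by move=> *; apply: modal_morphism_inj. Qed.
Next Obligation. by move=> *; apply: modal_morphism_inj. Qed.

Definition C4c d : category :=
  @full_subcategory (contact_category d)
    (fun A : contact_algebra d => complete_lattice A /\ contact4c A).

Definition KTBc d : category :=
  @full_subcategory (modal_category d)
    (fun A : modal_algebra d => complete_lattice A /\ KTB_algebra A).

(* Main.v *)
Require Import Defs.
From mathcomp Require Import all_boot all_order.
From mathcomp Require Import boolp classical_sets.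

(** In a complete contact algebra satisfying (C4^c), the join of all elements
    not in contact with [x] is itself not in contact with [x]; its complement
    [dia x] is the least element well inside of which [x] lies, that is,
    [dia x <= y <-> x << y].  This adjunction determines [dia] from the contact
    relation and the contact relation from [dia].  Under it, (P1) says
    [dia (h x) <= h (dia x)] and (P2) says [h (dia x) <= dia (h x)]. *)

Set Implicit Arguments.
Unset Strict Implicit.
Unset Printing Implicit Defensive.

Import Order.Theory.
Local Open Scope order_scope.

#[local] Obligation Tactic := idtac.

(** * Equality of functors, and of structures on one carrier *)

Definition eq_hom (C : category) (A B : obj C) (e : A = B) : hom A B :=
  let: erefl := e in idm A.

(** The squares with [eq_hom] compare [fhom F f] with [f] although their types differ. Once the
    object map is replaced by [id], each [e A] is [erefl] by proof irrelevance and the square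
    collapses to [fhom F f = f]. *)
Lemma functor_eq_id (C : category) (F : functor C C)
    (e : forall A, fobj F A = A) :
  (forall A B (f : hom A B),
     compm (eq_hom (e B)) (fhom F f) = compm f (eq_hom (e A))) ->
  F = functor_id C.
Proof.
case: F e => Fo Fh Fid Fcomp /= e natF.
have Fo_id : Fo = id by apply: funext.
subst Fo.
have Fh_id : Fh = fun _ _ f => f.
  apply: functional_extensionality_dep => A.
  apply: functional_extensionality_dep => B; apply: funext => f.
  have := natF A B f.
  by rewrite !(Prop_irrelevance (e _) erefl) /= compm_id_l compm_id_r.
subst Fh; rewrite /functor_id.
by congr Functor; apply: Prop_irrelevance.
Qed.

Lemma contact_algebra_eq d (A : contact_algebra d) (C : A -> A -> Prop)
    c0 c1 c2 c3 c4 :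
  (forall x y, C x y <-> contact x y) ->
  @ContactAlgebra d A C c0 c1 c2 c3 c4 = A.
Proof.
case: A C c0 c1 c2 c3 c4 => B C' c0' c1' c2' c3' c4' /= C c0 c1 c2 c3 c4 CE.
have E : C = C' by apply: funext => x; apply: funext => y; apply: propext.
by subst C'; congr ContactAlgebra; apply: Prop_irrelevance.
Qed.

Lemma modal_algebra_eq d (A : modal_algebra d) (D : A -> A) d0 dU :
  D =1 dia -> @ModalAlgebra d A D d0 dU = A.
Proof.
case: A D d0 dU => B D' d0' dU' /= D d0 dU /funext E.
by subst D'; congr ModalAlgebra; apply: Prop_irrelevance.
Qed.

(* [pm_fun (eq_hom e)] can be compared with [id] because the two objects have
   convertible carriers. *)
Lemma pm_fun_eq_hom d (A : contact_algebra d) (C : A -> A -> Prop)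
    c0 c1 c2 c3 c4 AP CP (CE : forall x y, C x y <-> contact x y)
    (e : exist _ (@ContactAlgebra d A C c0 c1 c2 c3 c4) CP
           = exist _ A AP :> obj (C4c d)) :
  pm_fun (eq_hom e) = id.
Proof.
case: A C c0 c1 c2 c3 c4 AP CP CE e
  => B C' c0' c1' c2' c3' c4' /= C c0 c1 c2 c3 c4 AP CP CE e.
have E : C = C' by apply: funext => x; apply: funext => y; apply: propext.
subst C'; move: AP CP e.
rewrite (Prop_irrelevance c0' c0) (Prop_irrelevance c1' c1).
rewrite (Prop_irrelevance c2' c2) (Prop_irrelevance c3' c3).
rewrite (Prop_irrelevance c4' c4) => AP CP.
by rewrite (Prop_irrelevance AP CP) => e; rewrite (Prop_irrelevance e erefl).
Qed.

Lemma mm_fun_eq_hom d (A : modal_algebra d) (D : A -> A) d0 dU AP DP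
    (DE : D =1 dia)
    (e : exist _ (@ModalAlgebra d A D d0 dU) DP
           = exist _ A AP :> obj (KTBc d)) :
  mm_fun (eq_hom e) = id.
Proof.
case: A D d0 dU AP DP DE e => B D' d0' dU' /= D d0 dU AP DP /funext E.
subst D'.
rewrite (Prop_irrelevance d0' d0) (Prop_irrelevance dU' dU) in AP *.
by rewrite (Prop_irrelevance AP DP) => e; rewrite (Prop_irrelevance e erefl).
Qed.

(** * From contact to a modal operator *)

Lemma well_insideC d (A : contact_algebra d) (x y : A) :
  contact x y <-> ~ well_inside x (~` y).
Proof. by rewrite /well_inside complK not_notE. Qed.

Definition contact_dia d (A : contact_algebra d) (cA : complete_lattice A)
    (x : A) : A :=
  ~` sval (cid (cA [set y | ~ contact x y]%classic)).

(** Let [s] be the join of the elements not in contact with [x]; the left side puts the complement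
    of [y] below [s]. Were [x] in contact with that complement, it would touch [s] by (C3) and then
    a member of the family by (C4^c), which is absurd. Conversely, a complement not in contact with
    [x] belongs to the family. *)
Lemma contact_dia_le d (A : contact_algebra d) (cA : complete_lattice A)
    (x y : A) :
  contact4c A -> contact_dia cA x <= y <-> well_inside x y.
Proof.
rewrite /contact_dia /well_inside leCx => A4c.
case: cid => s /= sJ; split=> [ys xCy|]; last by case: sJ => + _; apply.
have [z /= nxz xz] := A4c _ _ _ sJ (contact3 ys xCy).
exact: nxz.
Qed.

Lemma contact_dia0 d (A : contact_algebra d) (cA : complete_lattice A) :
  contact4c A -> contact_dia cA \bot = \bot.
Proof.
move=> A4c; apply/eqP; rewrite -lex0.
by apply/(contact_dia_le _ _ _ A4c); apply: contact0.
Qed.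

Lemma contact_diaU d (A : contact_algebra d) (cA : complete_lattice A)
    (x y : A) :
  contact4c A ->
  contact_dia cA (x `|` y) = contact_dia cA x `|` contact_dia cA y.
Proof.
move=> A4c; apply/le_anti/andP; split.
  apply/(contact_dia_le _ _ _ A4c) => /contact2/contact4[] /contact2.
    by apply/(contact_dia_le _ _ _ A4c)/leUl.
  by apply/(contact_dia_le _ _ _ A4c)/leUr.
have wi := (contact_dia_le cA (x `|` y) _ A4c).1 (lexx _).
rewrite leUx; apply/andP; split; apply/(contact_dia_le _ _ _ A4c).
  by move=> /contact2/(contact3 (leUl x y))/contact2.
by move=> /contact2/(contact3 (leUr y x))/contact2.
Qed.

Definition modal_of_contact d (A : contact_algebra d)
    (AP : complete_lattice A /\ contact4c A) : modal_algebra d :=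
  @ModalAlgebra d A (contact_dia AP.1) (contact_dia0 AP.1 AP.2)
    (fun x y => contact_diaU AP.1 x y AP.2).

Lemma modal_of_contact_KTB d (A : contact_algebra d)
    (AP : complete_lattice A /\ contact4c A) :
  KTB_algebra (modal_of_contact AP).
Proof.
have diaP x y := contact_dia_le AP.1 x y AP.2.
split=> x /=.
  have /diaP wi := lexx (contact_dia AP.1 x).
  (* If [x] met the complement of its diamond, (C1) would put the nonzero meet in contact with that
     complement, and (C3) would enlarge the meet to [x], against [wi]. *)
  rewrite -[leRHS]complK -disj_leC; apply/eqP; apply: contrapT => n0.
  apply: wi; apply: contact2; apply: contact3 (leIl _ _) _.
  by apply: contact2; apply: contact1 (leIr _ _) n0.
(* By symmetry, [box x] touching the complement of [x] would deny that this complement is well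
   inside its own diamond. *)
by apply/diaP => /contact2; apply/diaP.
Qed.

(** * From a modal operator to contact *)

Lemma dia_homo d (A : modal_algebra d) : {homo (@dia d A) : x y / x <= y}.
Proof. by move=> x y /join_idPr <-; rewrite diaU leUl. Qed.

(** The hypothesis amounts to [y <= box (~ x)], with [~] for complement; apply [dia] and use
    [dia (box z) <= z]. This is what makes the contact relation symmetric. *)
Lemma KTB_dia_sym d (A : modal_algebra d) (x y : A) :
  KTB_algebra A -> dia x <= ~` y -> dia y <= ~` x.
Proof.
move=> [_ diabox]; rewrite lexC => /dia_homo yx; apply: le_trans yx _.
by have := diabox (~` x); rewrite /box complK.
Qed.

(** Equivalently, [dia x] and [y] have nonzero meet. *)
Definition modal_contact d (A : modal_algebra d) (x y : A) : Prop :=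
  ~ (dia x <= ~` y).

Section ContactOfModal.
Context d (A : modal_algebra d) (AP : KTB_algebra A).

Let mc0 (x : A) : ~ modal_contact \bot x.
Proof. by apply; rewrite dia0 le0x. Qed.

Let mc1 (x y : A) : x <= y -> x <> \bot -> modal_contact x y.
Proof.
move=> xy x0 dxy; apply: x0.
rewrite -(meetxx x); apply/eqP; rewrite disj_leC.
by rewrite (le_trans (AP.1 x)) // (le_trans dxy) // leC.
Qed.

Let mc2 (x y : A) : modal_contact x y -> modal_contact y x.
Proof. by move=> xCy /(KTB_dia_sym AP). Qed.

Let mc3 (x y z : A) : x <= y -> modal_contact z x -> modal_contact z y.
Proof. by move=> xy zCx dzy; apply: zCx; rewrite (le_trans dzy) // leC. Qed.

Let mc4 (x y z : A) :
  modal_contact x (y `|` z) -> modal_contact x y \/ modal_contact x z.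
Proof.
rewrite /modal_contact complU lexI => /negP.
by rewrite negb_and => /orP[] /negP; [left | right].
Qed.

Definition contact_of_modal : contact_algebra d :=
  ContactAlgebra mc0 mc1 mc2 mc3 mc4.

Lemma contact_of_modal_well_inside (x y : contact_of_modal) :
  well_inside x y <-> (dia (x : A) <= y).
Proof. by rewrite /well_inside /= /modal_contact complK not_notE. Qed.

(** If [x] touches no member of [J], the complement of [dia x] is an upper bound of [J], hence lies
    above the join [s]. *)
Lemma contact_of_modal_4c : contact4c contact_of_modal.
Proof.
move=> x J s [_ sJ] /= xCs; apply: contrapT => nJ; apply: xCs.
rewrite lexC; apply: sJ => y Jy; rewrite lexC.
by apply: contrapT => xCy; apply: nJ; exists y.
Qed.

End ContactOfModal.

(** * Morphisms *)

Lemma p_morphism_dia d (A1 A2 : contact_algebra d)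
    (P1 : complete_lattice A1 /\ contact4c A1)
    (P2 : complete_lattice A2 /\ contact4c A2) (h : p_morphism A1 A2) x :
  h (contact_dia P1.1 x) = contact_dia P2.1 (h x).
Proof.
have dia1 z y := contact_dia_le P1.1 z y P1.2.
have dia2 z y := contact_dia_le P2.1 z y P2.2.
have hm := boolean_morphism_homo (pm_bool h).
apply/le_anti/andP; split.
  (* (P2) is applied to [h x] being well inside its own diamond. *)
  have /dia2/pm_lift[y /dia1/hm xy hy] := lexx (contact_dia P2.1 (h x)).
  exact: le_trans xy hy.
apply/dia2; rewrite /well_inside -(bool_morphC (pm_bool h)) => /pm_contact.
by apply/dia1.
Qed.

Definition modal_of_p_morphism d (A1 A2 : contact_algebra d)
    (P1 : complete_lattice A1 /\ contact4c A1)
    (P2 : complete_lattice A2 /\ contact4c A2) (h : p_morphism A1 A2) :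
    modal_morphism (modal_of_contact P1) (modal_of_contact P2) :=
  @ModalMorphism d (modal_of_contact P1) (modal_of_contact P2) h (pm_bool h)
    (p_morphism_dia P1 P2 h).

Section PMorphismOfModal.
Context d (A1 A2 : modal_algebra d).
Context (P1 : KTB_algebra A1) (P2 : KTB_algebra A2) (h : modal_morphism A1 A2).

Let h_contact (x y : A1) : modal_contact (h x) (h y) -> modal_contact x y.
Proof.
move=> hxy xy; apply: hxy.
rewrite -(mm_dia h) -(bool_morphC (mm_bool h)).
exact: boolean_morphism_homo (mm_bool h) _ _ xy.
Qed.

Let h_lift (z : contact_of_modal P1) (y : contact_of_modal P2) :
  well_inside (h z : contact_of_modal P2) y ->
  exists2 x : contact_of_modal P1, well_inside z x & h x <= y.
Proof.
(* The witness [dia z] is the least element that [z] is well inside of. *)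
move=> /contact_of_modal_well_inside hzy; exists (dia (z : A1)).
  exact/contact_of_modal_well_inside.
by rewrite mm_dia.
Qed.

Definition p_morphism_of_modal :
    p_morphism (contact_of_modal P1) (contact_of_modal P2) :=
  @PMorphism d (contact_of_modal P1) (contact_of_modal P2) h (mm_bool h)
    h_contact h_lift.

End PMorphismOfModal.

(** * The two functors and their composites *)

Program Definition contact_to_modal d : functor (C4c d) (KTBc d) :=
  @Functor (C4c d) (KTBc d)
    (fun A => exist _ (modal_of_contact (svalP A))
                (conj (svalP A).1 (modal_of_contact_KTB (svalP A))))
    (fun A B f => modal_of_p_morphism (svalP A) (svalP B) f) _ _.
Next Obligation. by move=> *; apply: modal_morphism_inj. Qed.
Next Obligation. by move=> *; apply: modal_morphism_inj. Qed.

Program Definition modal_to_contact d : functor (KTBc d) (C4c d) :=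
  @Functor (KTBc d) (C4c d)
    (fun A => exist _ (contact_of_modal (svalP A).2)
                (conj (svalP A).1 (@contact_of_modal_4c d _ (svalP A).2)))
    (fun A B f => p_morphism_of_modal (svalP A).2 (svalP B).2 f) _ _.
Next Obligation. by move=> *; apply: p_morphism_inj. Qed.
Next Obligation. by move=> *; apply: p_morphism_inj. Qed.

Lemma contact_round_trip d (A : contact_algebra d)
    (AP : complete_lattice A /\ contact4c A) (x y : A) :
  @modal_contact d (modal_of_contact AP) x y <-> contact x y.
Proof.
rewrite /modal_contact well_insideC.
by split=> + /(contact_dia_le AP.1 _ _ AP.2).
Qed.

(** The two diamonds of [x] have the same upper bounds, so antisymmetry identifies them. *)
Lemma dia_round_trip d (A : modal_algebra d) (cA : complete_lattice A)
    (AP : KTB_algebra A) :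
  @contact_dia d (contact_of_modal AP) cA =1 dia.
Proof.
move=> x; have diaP y : contact_dia (A := contact_of_modal AP) cA x <= y <->
    dia (x : A) <= y.
  rewrite -contact_of_modal_well_inside.
  exact/contact_dia_le/contact_of_modal_4c.
by apply/le_anti/andP; split; apply/diaP.
Qed.

Lemma contact_modal_contact d :
  functor_comp (modal_to_contact d) (contact_to_modal d) = functor_id (C4c d).
Proof.
have e (A : obj (C4c d)) :
    fobj (functor_comp (modal_to_contact d) (contact_to_modal d)) A = A.
  case: A => A AP; apply: eq_exist => /=.
  by apply: contact_algebra_eq => x y; exact: contact_round_trip.
have eE A : pm_fun (eq_hom (e A)) = id.
  by case: A (e A) => A AP eA; apply: pm_fun_eq_hom; apply: contact_round_trip.
(* Both functors keep the underlying function of a morphism, so only the identities [eE] remain to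
   be inserted in the square. *)
apply: (functor_eq_id (e := e)) => A B f; apply: p_morphism_inj => /=.
by rewrite !eE.
Qed.

Lemma modal_contact_modal d :
  functor_comp (contact_to_modal d) (modal_to_contact d) = functor_id (KTBc d).
Proof.
have e (A : obj (KTBc d)) :
    fobj (functor_comp (contact_to_modal d) (modal_to_contact d)) A = A.
  case: A => A AP; apply: eq_exist => /=.
  by apply: modal_algebra_eq; exact: dia_round_trip.
have eE A : mm_fun (eq_hom (e A)) = id.
  by case: A (e A) => A AP eA; apply: mm_fun_eq_hom; apply: dia_round_trip.
apply: (functor_eq_id (e := e)) => A B f; apply: modal_morphism_inj => /=.
by rewrite !eE.
Qed.

Theorem theorem6p16 (d : Order.disp_t) : isomorphic_categories (C4c d) (KTBc d).
Proof.
exists (contact_to_modal d), (modal_to_contact d); split.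
  exact: contact_modal_contact.
exact: modal_contact_modal.
Qed.
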